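(* Let $\delta\ge0$, let $(X_k,d_k)$, $k=1,\ldots,l$, be metric spaces, and let $(X,d)$ be their $l_\infty$-product. If $(X_k,d_k)$ is $(n_k,\delta)$-hyperbolic for $k=1,\ldots,l$ (with integers $n_k\ge0$), then $(X,d)$ is $(n,\delta)$-hyperbolic for $n:=\sum_{k=1}^l n_k$. In particular, the $l_\infty$-product of $n$ Gromov $\delta$-hyperbolic metric spaces is $(n,\delta)$-hyperbolic.
   Context: The $l_\infty$-product of $(X_k,d_k)$, $k=1,\ldots,l$, is $X=\prod_{k=1}^lX_k$ with metric $d(x,y)=\max\{d_k(x_k,y_k):k=1,\ldots,l\}$. Let $n\ge 0$ be an integer and $I_n=\{\pm1,\ldots,\pm(n+1)\}$. For $\delta\ge 0$, a metric space $(X,d)$ is $(n,\delta)$-hyperbolic if for every family $(x_i)_{i\in I_n}$ of points of $X$ there is a permutation $\alpha\ne-\mathrm{id}$ of $I_n$ with $\sum_{i\in I_n}d(x_i,x_{-i})\le\sum_{i\in I_n}d(x_i,x_{\alpha(i)})+2\delta$. $X$ is Gromov $\delta$-hyperbolic if $d(x,x')+d(y,y')\le\max\{d(x,y)+d(x',y'),\,d(x,y')+d(x',y)\}+2\delta$ for all $x,x',y,y'\in X$. *)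

(* Defs.v *)
From HB Require Import structures.
From mathcomp Require Import all_boot all_order all_algebra all_fingroup.
From mathcomp Require Import all_classical all_reals all_analysis.
Set Implicit Arguments.
Unset Strict Implicit.
Unset Printing Implicit Defensive.
Import Order.TTheory GRing.Theory Num.Theory.
Local Open Scope ring_scope.

(* The index set {±1, ..., ±(n+1)}: (false, k) stands for k + 1 and (true, k)
   for -(k + 1), where 0 <= k <= n. *)
Definition signed_index (n : nat) : finType := (bool * 'I_n.+1)%type.

Definition sopp n (i : signed_index n) : signed_index n := (~~ i.1, i.2).

Lemma soppK n : involutive (@sopp n).
Proof. by case=> b k; rewrite /sopp /= negbK. Qed.

(* The permutation -id. *)
Definition sopp_perm n : {perm signed_index n} := perm (inv_inj (@soppK n)).

Definition hyperbolic (R : realType) (n : nat) (delta : R)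
    (X : metricType R) : Prop :=
  forall x : signed_index n -> X,
  exists2 alpha : {perm signed_index n}, alpha <> sopp_perm n &
    \sum_(i : signed_index n) mdist (x i) (x (sopp i)) <=
    \sum_(i : signed_index n) mdist (x i) (x (alpha i)) + 2 * delta.

Definition gromov_hyperbolic (R : realType) (delta : R)
    (X : metricType R) : Prop :=
  forall x x' y y' : X,
    mdist x x' + mdist y y' <=
    Num.max (mdist x y + mdist x' y') (mdist x y' + mdist x' y) + 2 * delta.

(* An alias carrying the maximum metric, distinct from the library's
   [prod_topology], which has no metric structure. *)
Definition linf_prod (R : realType) (l : nat) (X : 'I_l -> metricType R) :
  Type := forall k, X k.

Section LinfProd.
Variables (R : realType) (l : nat) (X : 'I_l -> metricType R).
Implicit Types x y z : linf_prod X.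

(* Distances being nonnegative, the default value 0 of the iterated maximum
   only matters for l = 0, where the product is a single point. *)
Definition linf_dist x y : R := \big[Num.max/0]_(k < l) mdist (x k) (y k).

Lemma linf_dist_ge x y k : mdist (x k) (y k) <= linf_dist x y.
Proof. exact: (le_bigmax _ (fun k => mdist (x k) (y k))). Qed.

Lemma linf_distxx x : linf_dist x x = 0.
Proof.
apply: (big_ind (fun r => r = 0)) => // [a b -> ->|k _]; first by rewrite maxxx.
exact: mdistxx.
Qed.

Lemma linf_dist_positivity x y : linf_dist x y = 0 -> x = y.
Proof.
move=> d0; apply: functional_extensionality_dep => k.
apply: mdist_positivity; apply/le_anti/andP; split; last exact: mdist_ge0.
by rewrite -d0 linf_dist_ge.
Qed.

Lemma linf_dist_sym x y : linf_dist x y = linf_dist y x.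
Proof. by apply: eq_bigr => k _; exact: metric_sym. Qed.

Lemma linf_dist_triangle y x z :
  linf_dist x z <= linf_dist x y + linf_dist y z.
Proof.
apply: bigmax_le => [|k _].
  by apply: addr_ge0; exact: bigmax_ge_id.
apply: (le_trans (metric_triangle _ (y k) _)).
by apply: lerD; exact: linf_dist_ge.
Qed.

HB.instance Definition _ := gen_eqMixin (linf_prod X).
HB.instance Definition _ := gen_choiceMixin (linf_prod X).
HB.instance Definition _ := @isMetric.Build R (linf_prod X) linf_dist
  linf_distxx linf_dist_positivity linf_dist_sym linf_dist_triangle.

End LinfProd.

(* Main.v *)
(* The distance between antipodal points x_i, x_{-i} of the product is attained
   in some coordinate k(i). There are 1 + \sum_k n_k antipodal pairs, so some
   factor k serves at least n_k + 1 of them; the permutation that X_k provides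
   for these pairs, extended by -id to the others, works in the product, since
   passing from d_k to d only increases the right-hand side. *)
Require Import Defs.
From mathcomp Require Import all_boot all_order all_algebra all_fingroup.
From mathcomp Require Import all_classical all_reals all_analysis.
From mathcomp Require Import lra.
Set Implicit Arguments.
Unset Strict Implicit.
Unset Printing Implicit Defensive.
Import Order.TTheory GRing.Theory Num.Theory.
Local Open Scope ring_scope.

(** Let [g] act on the image of [h] and fix the rest. The same recipe for the inverse of [g] undoes
    this map, which is therefore a bijection. *)
Lemma perm_extension (S T : finType) (h : T -> S) (g : {perm T}) :
  injective h ->
  exists2 g' : {perm S}, (forall t, g' (h t) = h (g t)) &
    (forall s, s \notin codom h -> g' s = s).
Proof.
move=> h_inj.
pose e (u : {perm T}) s := oapp (fun t => h (u t)) s [pick t | h t == s].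
have eh u t : e u (h t) = h (u t).
  rewrite /e; case: pickP => [t' /eqP/h_inj -> //|/(_ t)].
  by rewrite eqxx.
have eN u s : s \notin codom h -> e u s = s.
  move=> sN; rewrite /e; case: pickP => //= t /eqP hts.
  by rewrite -hts codom_f in sN.
have eK : cancel (e g) (e g^-1%g).
  move=> s; have [/codomP[t ->]|sN] := boolP (s \in codom h).
    by rewrite !eh permK.
  by rewrite !eN.
by exists (perm (can_inj eK)) => [t|s sN]; rewrite permE ?eh ?eN.
Qed.

Lemma sum_off_codom0 (V : nmodType) (S T : finType) (h : T -> S) (F : S -> V) :
  injective h -> (forall s, s \notin codom h -> F s = 0) ->
  \sum_s F s = \sum_t F (h t).
Proof.
move=> h_inj F0.
rewrite (bigID (mem (h @: [set: T]))) /= [X in _ + X]big1 ?addr0.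
  rewrite big_imset /=; last by move=> t u _ _; exact: h_inj.
  by apply: eq_bigl => t; rewrite inE.
move=> s sN; apply: F0; apply: contra sN => /codomP[t ->].
by apply: imset_f; rewrite inE.
Qed.

Lemma pigeonhole_sum (l m : nat) (n : 'I_l -> nat) (f : 'I_m -> 'I_l) :
  (\sum_(k < l) n k < m)%N -> exists k, (n k < #|[set p | f p == k]|)%N.
Proof.
move=> n_lt_m; apply/existsP; apply: contraLR n_lt_m => /existsPn fN.
rewrite -leqNgt -[X in (X <= _)%N]card_ord -sum1_card (partition_big f xpredT)//=.
apply: leq_sum => k _; rewrite sum1_card leqNgt; apply: contra (fN k) => h.
by apply: leq_trans h _; apply/subset_leq_card/fintype.subsetP => p; rewrite !inE.
Qed.

Lemma injection_into_set (T : finType) (A : {set T}) (m : nat) :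
  (m <= #|A|)%N -> exists2 g : 'I_m -> T, injective g & forall j, g j \in A.
Proof.
move=> mA; exists (fun j => enum_val (widen_ord mA j)) => [i j|j].
  by move=> /enum_val_inj/(congr1 val)/= ij; exact: val_inj.
exact: enum_valP.
Qed.

Lemma linf_distE (R : realType) (l : nat) (X : 'I_l -> metricType R)
    (x y : linf_prod X) :
  mdist x y = \big[Num.max/0]_(k < l) mdist (x k) (y k).
Proof. by []. Qed.

(** Distances are nonnegative, so once there is a factor the default 0 cannot exceed the true
    maximum. *)
Lemma linf_dist_attained (R : realType) (l : nat) (X : 'I_l -> metricType R)
    (x y : linf_prod X) :
  (0 < l)%N -> exists k, mdist x y = mdist (x k) (y k).
Proof.
case: l X x y => // l X x y _; rewrite linf_distE.
have [|k _ ->] := Order.TotalTheory.eq_bigmax (x := 0) (ord0 : 'I_l.+1)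
    xpredT (fun k => mdist (x k) (y k)) erefl.
  by move=> k _; exact: mdist_ge0.
by exists k.
Qed.

Lemma hyperbolic_linf_prod (R : realType) (delta : R) (l : nat)
    (X : 'I_l -> metricType R) (n : 'I_l -> nat) :
  0 <= delta -> (forall k, hyperbolic (n k) delta (X k)) ->
  hyperbolic (\sum_(k < l) n k)%N delta (linf_prod X).
Proof.
move=> delta_ge0 Xhyp x; set N := (\sum_(k < l) n k)%N in x *.
have [l0|l_gt0] := posnP l.
  (* Without factors all distances vanish, and any permutation other than -id serves. *)
  exists 1%g => [/permP/(_ (false, ord0))|]; first by rewrite perm1 permE.
  rewrite big1 => [|i _]; last first.
    by subst l; rewrite linf_distE big_ord0.
  by rewrite addr_ge0 ?mulr_ge0 // sumr_ge0 // => i _; exact: mdist_ge0.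
have [f fE] := fin_all_exists (fun p : 'I_N.+1 =>
  linf_dist_attained (x (false, p)) (x (true, p)) l_gt0).
have [k /injection_into_set[g g_inj gk]] := pigeonhole_sum f (ltnSn N).
(* [h] embeds [n k + 1] antipodal pairs whose distance is attained in factor [k]; it keeps signs,
   hence commutes with [sopp]. *)
pose h (t : signed_index (n k)) : signed_index N := (t.1, g t.2).
have h_inj : injective h by move=> [b i] [c j] [-> /g_inj ->].
have hopp t : sopp (h t) = h (sopp t) by [].
(* [f] is chosen on positive indices; symmetry of the metric covers the negative ones. *)
have dopp t : mdist (x (h t)) (x (sopp (h t))) =
    mdist (x (h t) k) (x (sopp (h t)) k).
  case: t => b j; have := gk j; rewrite inE => /eqP fk.
  have := fE (g j); rewrite fk; case: b => //= e.
  by rewrite metric_sym [RHS]metric_sym.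
have [a aN aP] := Xhyp k (fun t => x (h t) k).
(* Outside the image of [h], [c] is the identity, whereas -id is wanted: -id is divided out of [a]
   here and restored in [a']. *)
have [c ch cN] := perm_extension ((sopp_perm (n k))^-1 * a)%g h_inj.
pose a' := (sopp_perm N * c)%g.
have a'h t : a' (h t) = h (a t).
  rewrite permM permE hopp ch permM; congr (h (a _)).
  by rewrite -[sopp t](permE (inv_inj (@soppK (n k)))) permK.
have a'N s : s \notin codom h -> a' s = sopp s.
  move=> sN; rewrite permM permE cN //; apply: contra sN => /codomP[t st].
  by rewrite -(soppK s) st hopp codom_f.
exists a' => [a'E|].
  apply: aN; apply/permP => t; apply: h_inj.
  by rewrite -a'h a'E !permE hopp.
(* Off the image of [h] the two sums agree term by term and cancel. *)
rewrite -lerBlDl -sumrB (sum_off_codom0 h_inj) => [|s /a'N ->]; last first.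
  by rewrite subrr.
rewrite sumrB lerBlDl (eq_bigr _ (fun t _ => dopp t)) (le_trans aP) // lerD2r.
by apply: ler_sum => t _; rewrite a'h; exact: linf_dist_ge.
Qed.

Lemma gromov_hyperbolic_hyperbolic (R : realType) (delta : R)
    (X : metricType R) :
  gromov_hyperbolic delta X -> hyperbolic 1 delta X.
Proof.
move=> Xhyp x.
pose i1 : signed_index 1 := (false, ord0).
pose i2 : signed_index 1 := (false, ord_max).
have sumE F : \sum_(i : signed_index 1) F i =
    F i1 + F (sopp i1) + F i2 + F (sopp i2) :> R.
  rewrite (eq_bigr (fun i => F (i.1, i.2))); last by case.
  rewrite -(pair_bigA _ (fun b k => F (b, k))) big_bool /= !big_ord_recl !big_ord0.
  have -> : lift ord0 ord0 = ord_max :> 'I_2 by exact: val_inj.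
  by rewrite /i1 /i2 /sopp /=; lra.
(* With a fixed-point-free involution both sides are doubled and the error is
   4 delta; the 4-cycle i1 -> -i1 -> j -> -j -> i1 keeps one copy of the
   left-hand side of Gromov's inequality, so that the error is 2 delta. *)
have cycle4 j : j = i2 \/ j = sopp i2 ->
    mdist (x i1) (x (sopp i1)) + mdist (x i2) (x (sopp i2)) <=
    mdist (x (sopp i1)) (x j) + mdist (x (sopp j)) (x i1) + 2 * delta ->
    exists2 alpha : {perm signed_index 1}, alpha <> sopp_perm 1 &
    \sum_i mdist (x i) (x (sopp i)) <= \sum_i mdist (x i) (x (alpha i)) + 2 * delta.
  (* The 4-cycle arises as -id followed by the swap of [i1] and [j]; it differs from -id at
     [sopp i1]. *)
  move=> jE le_d; exists (sopp_perm 1 * tperm i1 j)%g.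
    move=> /permP/(_ (sopp i1)); rewrite permM !permE soppK /= => ji1.
    by case: jE ji1 => ->.
  have sumjE F : \sum_(i : signed_index 1) F i =
      F i1 + F (sopp i1) + F j + F (sopp j) :> R.
    by rewrite sumE; case: jE => -> //; rewrite soppK; lra.
  rewrite [leLHS]sumE [X in _ <= X + _]sumjE !permM.
  rewrite ![sopp_perm 1 _]permE !soppK tpermL tpermR !tpermD //; [|by case: jE => ->..].
  rewrite (metric_sym (x (sopp i1)) (x i1)) (metric_sym (x (sopp i2)) (x i2)).
  suff : mdist (x j) (x (sopp j)) = mdist (x i2) (x (sopp i2)) by move=> ->; lra.
  by case: jE => -> //; rewrite soppK metric_sym.
have := Xhyp (x i1) (x (sopp i1)) (x i2) (x (sopp i2)).
(* The cycle sends [sopp i1] to [j] and [sopp j] to [i1], so the pairing that realises the maximum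
   dictates the sign of [j]. *)
rewrite addr_maxl le_max => /orP[le_d|le_d].
  apply: (cycle4 (sopp i2)); first by right.
  by rewrite soppK (metric_sym (x i2) (x i1)); lra.
apply: (cycle4 i2); first by left.
by rewrite (metric_sym (x (sopp i2)) (x i1)); lra.
Qed.

Theorem proposition2p4 (R : realType) (delta : R) (delta_ge0 : 0 <= delta) :
  (forall (l : nat) (X : 'I_l -> metricType R) (n : 'I_l -> nat),
     (forall k : 'I_l, hyperbolic (n k) delta (X k)) ->
     hyperbolic (\sum_(k < l) n k)%N delta (linf_prod X)) /\
  (forall (n : nat) (X : 'I_n -> metricType R),
     (forall k : 'I_n, gromov_hyperbolic delta (X k)) ->
     hyperbolic n delta (linf_prod X)).
Proof.
split=> [l X n|n X Xhyp]; first exact: hyperbolic_linf_prod.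
(* [n] is written as a sum of ones, one for each factor. *)
rewrite -[n in hyperbolic n](card_ord n) -sum1_card.
by apply: hyperbolic_linf_prod => // k; exact: gromov_hyperbolic_hyperbolic.
Qed.
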